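(* Let $V_0$ be a real vector space, $\Theta\subset V_0$, let $(V,\mathcal{B}(V))$ and $(W,\mathcal{B}(W))$ be measurable vector spaces with $(W,\mathcal{B}(W))$ a standard Borel space, let $h:V_0\to V$ be linear and injective, let $f:V\to W$ be linear and measurable, and put $g:=f\circ h_{|\Theta}:\Theta\to W$. Let $P$ be a probability distribution on $(V,\mathcal{B}(V))$ and $Q$ a probability distribution on $(W,\mathcal{B}(W))$, and suppose there is a Markov kernel $K:V\times\mathcal{B}(W)\to[0,1]$ with $$Q\ast\varepsilon_{g(\vartheta)}(\cdot)=\int K(x,\cdot)\,P\ast\varepsilon_{h(\vartheta)}(dx)\qquad\text{for all }\vartheta\in\Theta .$$ For $\vartheta\in\Theta$ let $\mu_\vartheta$ be the probability measure on $(V\times W,\mathcal{B}(V)\otimes\mathcal{B}(W))$ determined by $$\mu_\vartheta(A\times B)=\int_A K(x,B)\,P\ast\varepsilon_{h(\vartheta)}(dx),\qquad A\in\mathcal{B}(V),\ B\in\mathcal{B}(W),$$ and let $\Pi_1:V\times W\to V$, $\Pi_2:V\times W\to W$ be the coordinate projections. Let $\Theta_1\subset\Theta$ be a non-empty subset with $\Theta_1+\Theta_1\subset\Theta$ such that $\{P\ast\varepsilon_{h(\vartheta)}:\vartheta\in\Theta_1\}$ is boundedly complete. Then: (a) The distribution $\nu:=\mathcal{L}(\Pi_2-f(\Pi_1)\,|\,\mu_\vartheta)$ does not depend on $\vartheta\in\Theta_1$, i.e. $\Pi_2-f(\Pi_1)$ is an ancillary statistic with respect to $\Theta_1$. Moreover,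 $\Pi_1$ and $\Pi_2-f(\Pi_1)$ are $\mu_\vartheta$-independent for all $\vartheta\in\Theta_1$. (b) For each $\vartheta\in\Theta$ we have $$Q\ast\varepsilon_{g(\vartheta)}=\nu\ast\mathcal{L}(f|P)\ast\varepsilon_{g(\vartheta)} .$$
   Context: A measurable vector space is a real vector space with a $\sigma$-field for which the vector space operations are measurable. A standard Borel space here is a measurable (Borel) subset of a Polish space with its Borel $\sigma$-field. $\varepsilon_x$ is the Dirac measure at $x$, $\ast$ is convolution, and $\mathcal{L}(Y|P)$ is the distribution of $Y$ under $P$. A family $\mathcal{P}$ of probability measures on $(V,\mathcal{B}(V))$ is boundedly complete if every bounded measurable $\varphi:V\to\mathbb{R}$ with $\int\varphi\,dR=0$ for all $R\in\mathcal{P}$ satisfies $\varphi=0$ $R$-a.e. for all $R\in\mathcal{P}$. *)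

(* Defs.v *)
(* The real numbers are an arbitrary [R : realType]. *)
From HB Require Import structures.
From mathcomp Require Import all_boot all_order all_algebra.
From mathcomp Require Import all_classical all_reals all_analysis.

Set Implicit Arguments.
Unset Strict Implicit.
Unset Printing Implicit Defensive.
Import Order.TTheory GRing.Theory Num.Theory.
Import numFieldNormedType.Exports.

Local Open Scope classical_set_scope.
Local Open Scope ring_scope.

(* The sigma-field is put on top of the module structure and the measurable
   type is derived from it, because a join of [Measurable] and [GRing.Lmodule]
   clashes with the library's joins of pointed types and modules. *)
HB.mixin Record Lmodule_hasSigmaField (R : realType) (d : measure_display) V
    & GRing.Lmodule R V := {
  sigma_field : set (set V) ;
  sigma_field0 : sigma_field set0 ;
  sigma_fieldC : forall A, sigma_field A -> sigma_field (~` A) ;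
  sigma_field_bigcup : forall A : (set V)^nat, (forall i, sigma_field (A i)) ->
    sigma_field (\bigcup_i (A i))
}.

#[short(type="sigmaLmodType")]
HB.structure Definition SigmaLmodule (R : realType) (d : measure_display) :=
  {V of GRing.Lmodule R V & Lmodule_hasSigmaField R d V}.

HB.instance Definition _ (R : realType) d (V : sigmaLmodType R d) :=
  isPointed.Build V 0.

HB.instance Definition _ (R : realType) d (V : sigmaLmodType R d) :=
  isMeasurable.Build d V (@sigma_field0 R d V) (@sigma_fieldC R d V)
    (@sigma_field_bigcup R d V).

(* The operations are jointly measurable, for the product sigma-fields on
   V * V and R * V, where R carries its Borel sigma-field. *)
Structure measurableLmodType (R : realType) (d : measure_display) := {
  measurableLmod_sort :> sigmaLmodType R d ;
  measurable_addv :
    measurable_fun [set: measurableLmod_sort * measurableLmod_sort]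
      (fun z : measurableLmod_sort * measurableLmod_sort => z.1 + z.2) ;
  measurable_scalev :
    measurable_fun [set: measurableTypeR R * measurableLmod_sort]
      (fun z : measurableTypeR R * measurableLmod_sort => (z.1 : R) *: z.2)
}.

#[short(type="completeMetricType")]
HB.structure Definition CompleteMetric (R : numDomainType) :=
  {E of Metric R E & Complete E}.

(* Separable complete metric spaces present exactly the nonempty Polish spaces;
   a measurable type is inhabited, so the empty one is not needed. The map [i]
   identifies [S] with a Borel subset of [E] carrying the trace of the Borel
   sigma-field [<<s open >>]. *)
Definition standard_borel (R : realType) d (S : measurableType d) : Prop :=
  exists (E : completeMetricType R) (i : S -> E),
    [/\ exists2 D : set E, countable D & dense D,
        injective i,
        <<s @open E >> (range i) &
        @measurable d S = preimage_set_system [set: S] i <<s @open E >>].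

Section convolution.
Context (R : realType) d (V : measurableLmodType R d).

Definition addv_pair (z : V * V) : V := z.1 + z.2.

HB.instance Definition _ :=
  isMeasurableFun.Build _ _ (V * V)%type V addv_pair
    (@measurable_addv R d V).

Definition convolution (P Q : probability V R) : probability V R :=
  distribution (P \x Q)%E addv_pair.

End convolution.

Definition boundedly_complete (R : realType) d (T : measurableType d)
    (F : set (probability T R)) : Prop :=
  forall phi : T -> R, measurable_fun [set: T] phi -> bounded_fun phi ->
    (forall P, F P -> \int[P]_x (phi x)%:E = 0)%E ->
    forall P, F P -> {ae P, forall x, phi x = 0}.

Definition independent_rv (R : realType) d d1 d2 (T : measurableType d)
    (T1 : measurableType d1) (T2 : measurableType d2) (P : probability T R)
    (X : T -> T1) (Y : T -> T2) : Prop :=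
  forall A B, measurable A -> measurable B ->
    (P (X @^-1` A `&` Y @^-1` B) = P (X @^-1` A) * P (Y @^-1` B))%E.

(* Main.v *)
Require Import Defs.
From HB Require Import structures.
From mathcomp Require Import all_boot all_order all_algebra.
From mathcomp Require Import all_classical all_reals all_analysis.
From mathcomp Require Import measurable_realfun.

Set Implicit Arguments.
Unset Strict Implicit.
Unset Printing Implicit Defensive.
Import Order.TTheory GRing.Theory Num.Theory.
Import numFieldNormedType.Exports.

Local Open Scope classical_set_scope.
Local Open Scope ring_scope.

(** Write P_t for P * eps_(h t), g for f o h and T (x, w) = w - f x for the
    residual of the second coordinate after subtracting f of the first.

    Translating by an element s of Theta1 carries the kernel to itself: for t in
    Theta1 the sum t + s is still in Theta, so
      int K(x + h s, B + g s) dP_t = Q * eps_(g(t + s)) (B + g s)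
                                   = Q * eps_(g t) (B) = int K(x, B) dP_t,
    and bounded completeness turns the equality of integrals into
    K(x + h s, B + g s) = K(x, B) for P_t-almost every x
    ([kernel_equivariance]). The null set depends on B; this is harmless because
    the equality is integrated over measurable rectangles, which determine a
    finite measure, and gives at once that mu_(t + s) is the image of mu_t under
    translation by (h s, g s) ([joint_law_equivariance]).

    By linearity of f the residual T is invariant under these translations,
    hence has the same law under mu_t, mu_(t + s) and mu_s: this is the
    ancillarity, with nu the common law. The number nu(C) is the integral
    against P_t of the conditional probability x |-> K(x, {w | w - f x in C}),
    so bounded completeness, used a second time, says that this conditional
    probability is almost surely the constant nu(C) ([residual_law_const]), as
    in Basu's theorem. Integrating it over a set of first coordinates gives the
    independence ([residual_product_law]).

    For the factorization, the second coordinate is T + f(Pi_1), a sum of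
    independent terms, so Q * eps_(g t) = nu * L(f | P) * eps_(g t) for one t
    in Theta1 ([recompose_law]). Dirac factors can be translated away, so the
    identity for one point gives it for all ([convolution_dirac_eq]). *)

(** * Translations and convolution with a Dirac measure *)

Lemma measurable_fun_addv (R : realType) (d0 d : measure_display)
    (T : measurableType d0) (V : measurableLmodType R d) (u v : T -> V) :
  measurable_fun setT u -> measurable_fun setT v ->
  measurable_fun setT (fun x => u x + v x).
Proof.
move=> mu mv.
exact: (measurableT_comp (@measurable_addv R d V) (measurable_fun_pair mu mv)).
Qed.

Lemma measurable_fun_oppv (R : realType) (d0 d : measure_display)
    (T : measurableType d0) (V : measurableLmodType R d) (u : T -> V) :
  measurable_fun setT u -> measurable_fun setT (fun x => - u x).
Proof.
move=> mu.
pose c : T -> measurableTypeR R := cst (-1).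
have mc : measurable_fun setT c by exact: measurable_cst.
have := measurableT_comp (@measurable_scalev R d V) (measurable_fun_pair mc mu).
by apply: eq_measurable_fun => x _; rewrite /c /= scaleN1r.
Qed.

Lemma measurable_translation (R : realType) (d : measure_display)
    (V : measurableLmodType R d) (v : V) :
  measurable_fun setT (fun x : V => x + v).
Proof.
by apply: measurable_fun_addv; [exact: measurable_id|exact: measurable_cst].
Qed.

Lemma measurable_translate (R : realType) (d : measure_display)
    (V : measurableLmodType R d) (v : V) (B : set V) :
  measurable B -> measurable [set x | B (x + v)].
Proof.
by move=> mB; rewrite -[X in measurable X]setTI; exact: measurable_translation.
Qed.

Lemma prob_kernel_itv (R : realType) (d1 d2 : measure_display)
    (X : measurableType d1) (Y : measurableType d2) (k : R.-pker X ~> Y)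
    (x : X) (B : set Y) :
  measurable B -> (0 <= k x B <= 1)%E.
Proof.
by move=> mB; rewrite measure_ge0/= -(prob_kernel x (s := k)) le_measure// inE.
Qed.

Lemma convolution_diracE (R : realType) (d : measure_display)
    (V : measurableLmodType R d) (P : probability V R) (v : V) (B : set V) :
  measurable B ->
  convolution P \d_v B = P [set x | B (x + v)].
Proof.
move=> mB.
have mT := measurable_translate v mB.
rewrite -(setIT [set x | B (x + v)]) -integral_indic//.
apply: eq_integral => x _.
by rewrite /comp /= /dirac !indicE mem_xsection; congr (_%:R%:E).
Qed.

Lemma integral_convolution_dirac (R : realType) (d : measure_display)
    (V : measurableLmodType R d) (P : probability V R) (v : V)
    (A : set V) (phi : V -> \bar R) :
  measurable A -> measurable_fun setT phi -> (forall x, 0 <= phi x)%E ->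
  (\int[convolution P \d_v]_(x in A) phi x
   = \int[P]_(x in [set x | A (x + v)%R]) phi (x + v)%R)%E.
Proof.
move=> mA mphi phi0.
pose tr (x : V) := x + v.
rewrite (eq_measure_integral (pushforward P tr)) => [|mv|mv B mB _].
- exact: measurable_translation.
- by rewrite ge0_integral_pushforward//; exact: measurable_funTS.
- exact: convolution_diracE.
Qed.

Lemma integral_convolution_diracD (R : realType) (d : measure_display)
    (V : measurableLmodType R d) (P : probability V R) (u v : V)
    (A : set V) (phi : V -> \bar R) :
  measurable A -> measurable_fun setT phi -> (forall x, 0 <= phi x)%E ->
  (\int[convolution P \d_(u + v)%R]_(x in A) phi x
   = \int[convolution P \d_u]_(x in [set x | A (x + v)%R]) phi (x + v)%R)%E.
Proof.
move=> mA mphi phi0.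
rewrite !integral_convolution_dirac//.
- rewrite (_ : [set x | A (x + (u + v))] = [set x | A (x + u + v)]).
    by apply: eq_integral => x _; rewrite addrA.
  by apply/seteqP; split=> x /=; rewrite addrA.
- exact: measurable_translate.
- by apply: (measurableT_comp mphi); exact: measurable_translation.
Qed.

Lemma convolution_diracD (R : realType) (d : measure_display)
    (V : measurableLmodType R d) (P : probability V R) (u v : V) (B : set V) :
  measurable B ->
  convolution P \d_(u + v) B = convolution P \d_u [set x | B (x + v)].
Proof.
move=> mB; rewrite !convolution_diracE//; last exact: measurable_translate.
by congr (P _); apply/seteqP; split=> x /=; rewrite addrA.
Qed.

(** * Laws on a product: rectangles and disintegration *)

Lemma eq_finite_measure_rectangles (R : realType) (d1 d2 : measure_display)
    (X : measurableType d1) (Y : measurableType d2)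
    (m1 m2 : {measure set (X * Y) -> \bar R}) :
  (m1 setT < +oo)%E ->
  (forall A B, measurable A -> measurable B -> m1 (A `*` B) = m2 (A `*` B)) ->
  forall D, measurable D -> m1 D = m2 D.
Proof.
move=> fin m12.
pose G : set (set (X * Y)) := [set A `*` B | A in measurable & B in measurable].
apply: (measure_unique G (fun=> setT)) => //.
- exact: measurable_prod_measurableType.
- move=> _ _ [A mA [B mB <-]] [A' mA' [B' mB' <-]]; rewrite -setXI.
  exists (A `&` A'); first exact: measurableI.
  by exists (B `&` B') => //; exact: measurableI.
- by move=> _; exists setT => //; exists setT => //; rewrite setXTT.
- by rewrite bigcup_const//; exists 0%N.
- by move=> _ [A mA [B mB <-]]; exact: m12.
Qed.

Section semidirect_product.
Context (R : realType) (d1 d2 : measure_display) (X : measurableType d1)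
  (Y : measurableType d2) (l : {measure set X -> \bar R}) (k : R.-pker X ~> Y).
Local Open Scope ereal_scope.

(** The section formula is made into a measure, so that it can then
    be identified with a given joint law by comparing rectangles only. *)
Definition semidirect_product (D : set (X * Y)) : \bar R :=
  \int[l]_x k x (xsection D x).

Let semidirect_product0 : semidirect_product set0 = 0.
Proof. by rewrite [LHS]integral0_eq// => x _; rewrite xsection0 measure0. Qed.

Let semidirect_product_ge0 D : 0 <= semidirect_product D.
Proof. exact: integral_ge0. Qed.

Let semidirect_product_sigma_additive : semi_sigma_additive semidirect_product.
Proof.
move=> F mF tF mUF.
rewrite [X in _ --> X](_ : _ = \sum_(n <oo) semidirect_product (F n)).
  by apply/cvg_closeP; split; [exact: is_cvg_nneseries|rewrite closeE].
rewrite -integral_nneseries//; last first.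
  by move=> n; apply: measurable_fun_xsection_finite_kernel; rewrite inE.
apply: eq_integral => x _; apply/esym/cvg_lim => //=; rewrite xsection_bigcup.
apply: (measure_sigma_additive _ (trivIset_xsection tF)) => ?.
exact: measurable_xsection.
Qed.

HB.instance Definition _ := isMeasure.Build _ _ _ semidirect_product
  semidirect_product0 semidirect_product_ge0 semidirect_product_sigma_additive.

Lemma semidirect_productX A B : measurable A -> measurable B ->
  semidirect_product (A `*` B) = \int[l]_(x in A) k x B.
Proof.
move=> mA mB; rewrite [RHS]integral_mkcond; apply: eq_integral => x _.
rewrite patchE; case: ifPn => xA; first by rewrite in_xsectionX.
by rewrite notin_xsectionX// measure0.
Qed.

End semidirect_product.

(** A joint law is described by a kernel on rectangles; the event that the
    residual lies in a given set is not a rectangle, and its probability is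
    reached through sections. *)
Lemma disintegration (R : realType) (d1 d2 : measure_display)
    (X : measurableType d1) (Y : measurableType d2)
    (l : {measure set X -> \bar R}) (k : R.-pker X ~> Y)
    (m : probability (X * Y)%type R) :
  (forall A B, measurable A -> measurable B ->
     m (A `*` B) = \int[l]_(x in A) k x B)%E ->
  forall D, measurable D -> (m D = \int[l]_x k x (xsection D x))%E.
Proof.
move=> mE; apply: (eq_finite_measure_rectangles (m2 := semidirect_product l k)).
  by rewrite (le_lt_trans (probability_le1 m measurableT)) ?ltry.
move=> A B mA mB.
exact: (etrans (mE A B mA mB) (esym (semidirect_productX l k mA mB))).
Qed.

(** * Equivariance of the kernel and of the joint law *)

(** The form in which completeness gets used: conditional probabilities are
    extended-real valued, and two of them are compared through the bounded real
    function given by the difference of their finite parts. *)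
Lemma boundedly_complete_ae_eq (R : realType) (d : measure_display)
    (T : measurableType d) (F : set (probability T R)) (phi psi : T -> \bar R) :
  boundedly_complete F ->
  measurable_fun setT phi -> measurable_fun setT psi ->
  (forall x, 0 <= phi x <= 1)%E -> (forall x, 0 <= psi x <= 1)%E ->
  (forall P, F P -> \int[P]_x phi x = \int[P]_x psi x)%E ->
  forall P, F P -> {ae P, forall x, phi x = psi x}.
Proof.
move=> Fc mphi mpsi phi01 psi01 eqint P FP.
have fin (g : T -> \bar R) (g01 : forall x, (0 <= g x <= 1)%E) x :
    g x = (fine (g x))%:E.
  have /andP[g0 g1] := g01 x.
  by rewrite fineK// ge0_fin_numE// (le_lt_trans g1) ?ltry.
have mf (g : T -> \bar R) : measurable_fun setT g ->
    measurable_fun setT (fun x => fine (g x)).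
  by move=> mg; apply: measurableT_comp mg; exact: fine_measurable.
have bd (g : T -> \bar R) (g01 : forall x, (0 <= g x <= 1)%E) x :
    0 <= fine (g x) <= 1.
  by have := g01 x; rewrite (fin g g01) !lee_fin.
have intg (g : T -> \bar R) (P' : probability T R) :
    measurable_fun setT g -> (forall x, (0 <= g x <= 1)%E) ->
    P'.-integrable setT (EFin \o (fun x => fine (g x))).
  move=> mg g01; apply: measurable_bounded_integrable => //.
  - by rewrite (le_lt_trans (probability_le1 P' measurableT)) ?ltry.
  - exact: mf.
  exists 1; split => // M M1 x _ /=.
  have /andP[g0 g1] := bd _ g01 x.
  by rewrite ger0_norm// (le_trans g1)// ltW.
have := Fc (fun x => fine (phi x) - fine (psi x)) _ _ _ P FP; case.
- by apply: measurable_funB; exact: mf.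
(* The bound 2 is the triangle inequality for two functions bounded by 1. *)
- exists 2; split => // M M2 x _ /=.
  have /andP[a0 a1] := bd _ phi01 x; have /andP[b0 b1] := bd _ psi01 x.
  rewrite (le_trans (ler_normB _ _))// (le_trans _ (ltW M2))//.
  by rewrite !ger0_norm// (_ : 2 = 1 + 1) ?lerD// -[2]/(1 + 1)%N%:R natrD.
- move=> P' FP'; under eq_integral do rewrite EFinB.
  rewrite integralB_EFin//; [|exact: intg|exact: intg].
  under eq_integral do rewrite -fin//.
  under [X in (_ - X)%E]eq_integral do rewrite -fin//.
  rewrite eqint// subee//.
  rewrite (eq_integral (fun x => (fine (psi x))%:E)).
    by apply: integrable_fin_num; [|exact: intg].
  by move=> x _; exact: fin.
move=> N [mN N0 sub]; exists N; split => // x /= neq; apply: sub => /= e.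
apply: neq; rewrite (fin _ phi01) (fin _ psi01).
by move/eqP : e; rewrite subr_eq0 => /eqP ->.
Qed.

(** Both sides have integral Q * eps_(g u) (B - g s) against P_u, for every u in
    Theta1: on the left the shift is absorbed into P_(u + s), on the right it
    comes out of the hypothesis on K at u itself. *)
Lemma kernel_equivariance (R : realType) (V0 : nmodType) (Theta : set V0)
    (dV dW : measure_display)
    (V : measurableLmodType R dV) (W : measurableLmodType R dW)
    (h : V0 -> V) (g : V0 -> W)
    (hD : {morph h : s t / s + t}) (gD : {morph g : s t / s + t})
    (P : probability V R) (Q : probability W R) (K : R.-pker V ~> W)
    (K_conv : forall t, Theta t -> forall B : set W, measurable B ->
       (convolution Q \d_(g t) B = \int[convolution P \d_(h t)]_x K x B)%E)
    (Theta1 : set V0) (Theta1_sub : Theta1 `<=` Theta)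
    (Theta1D : forall s t, Theta1 s -> Theta1 t -> Theta (s + t))
    (Theta1_complete :
       boundedly_complete [set convolution P \d_(h t) | t in Theta1]) :
  forall s t, Theta1 s -> Theta1 t -> forall B : set W, measurable B ->
  {ae convolution P \d_(h t),
    forall x, K (x + h s) B = K x [set w | B (w + g s)]}.
Proof.
move=> s t Ts Tt B mB.
have mBs := measurable_translate (g s) mB.
have mK C : measurable C -> measurable_fun setT (fun x => K x C).
  by move=> mC; exact: measurable_kernel.
apply: (boundedly_complete_ae_eq Theta1_complete).
- by apply: (measurableT_comp (mK _ mB)); exact: measurable_translation.
- exact: mK.
- by move=> x; exact: prob_kernel_itv.
- by move=> x; exact: prob_kernel_itv.
- move=> _ [u Tu <-].
  transitivity (\int[convolution P \d_(h u + h s)%R]_x K x B)%E.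
    by rewrite integral_convolution_diracD//; exact: mK.
  rewrite -hD -K_conv//; last exact: Theta1D.
  by rewrite gD convolution_diracD// K_conv//; exact: Theta1_sub.
- by exists t.
Qed.

(** The exceptional null set in the hypothesis on K may depend on B, since on a
    rectangle only one B is involved. *)
Lemma joint_law_equivariance (R : realType) (dV dW : measure_display)
    (V : measurableLmodType R dV) (W : measurableLmodType R dW)
    (P : probability V R) (K : R.-pker V ~> W)
    (u v : V) (w : W) (m m' : probability (V * W)%type R)
    (mE : forall A B, measurable A -> measurable B ->
       (m (A `*` B) = \int[convolution P \d_u]_(x in A) K x B)%E)
    (m'E : forall A B, measurable A -> measurable B ->
       (m' (A `*` B) = \int[convolution P \d_(u + v)%R]_(x in A) K x B)%E)
    (Kvw : forall B : set W, measurable B -> {ae convolution P \d_u,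
       forall x, K (x + v) B = K x [set y | B (y + w)]}) :
  forall D, measurable D -> m' D = m [set z | D (z.1 + v, z.2 + w)].
Proof.
pose shift (z : V * W) : V * W := (z.1 + v, z.2 + w).
have mshift : measurable_fun setT shift.
  apply: measurable_fun_pair; apply: measurable_fun_addv;
    by [exact: measurable_fst|exact: measurable_snd|exact: measurable_cst].
pose m2 : probability (V * W)%type R :=
  distribution m (mfun_Sub (mem_set mshift)).
move=> D mD.
transitivity (m2 D); last by [].
apply: (eq_finite_measure_rectangles (m1 := m') (m2 := m2) _ _ mD).
  by rewrite (le_lt_trans (probability_le1 m' measurableT)) ?ltry.
move=> A B mA mB.
have mK C : measurable C -> measurable_fun setT (fun x => K x C).
  by move=> mC; exact: measurable_kernel.
transitivity (m ([set x | A (x + v)] `*` [set y | B (y + w)])); last by [].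
etransitivity; first exact: m'E.
etransitivity; last by apply/esym/mE; exact: measurable_translate.
rewrite integral_convolution_diracD//; last exact: mK.
apply: ge0_ae_eq_integral => //.
- exact: measurable_translate.
- apply: measurable_funTS; apply: (measurableT_comp (mK _ mB)).
  exact: measurable_translation.
- by apply: measurable_funTS; apply: mK; exact: measurable_translate.
- by move: (Kvw B mB); apply: filterS => x ? _.
Qed.

(** * Law of the residual *)

Section residual.
Context (R : realType) (dV dW : measure_display) (V : measurableLmodType R dV)
  (W : measurableLmodType R dW) (f : {mfun V >-> W}).

Definition residual (z : V * W) : W := z.2 - f z.1.

Lemma measurable_residual : measurable_fun setT residual.
Proof.
apply: measurable_fun_addv; first exact: measurable_snd.
by apply: measurable_fun_oppv; apply: measurableT_comp.
Qed.

HB.instance Definition _ := isMeasurableFun.Build _ _ (V * W)%type W residual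
  measurable_residual.

Lemma measurable_residual_preimage (C : set W) :
  measurable C -> measurable (residual @^-1` C).
Proof.
by move=> mC; rewrite -[X in measurable X]setTI; exact: measurable_residual.
Qed.

End residual.

(** Given the first coordinate x, the residual lies in C with probability
    K(x, C + f x), written below as a section of its preimage. When this does
    not depend on x, the residual is independent of the first coordinate. *)
Lemma residual_product_law (R : realType) (dV dW : measure_display)
    (V : measurableLmodType R dV) (W : measurableLmodType R dW)
    (f : {mfun V >-> W}) (l : probability V R) (K : R.-pker V ~> W)
    (m : probability (V * W)%type R)
    (mE : forall A B, measurable A -> measurable B ->
       (m (A `*` B) = \int[l]_(x in A) K x B)%E)
    (C : set W) (mC : measurable C) (c : \bar R) (c0 : (0 <= c)%E)
    (Kc : {ae l, forall x, K x (xsection (residual f @^-1` C) x) = c})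
    (A : set V) (mA : measurable A) :
  m (fst @^-1` A `&` residual f @^-1` C) = (l A * c)%E.
Proof.
have mTC := measurable_residual_preimage f mC.
have mfA : measurable (fst @^-1` A : set (V * W)).
  by rewrite -[X in measurable X]setTI; exact: measurable_fst.
rewrite (disintegration mE); last exact: measurableI.
rewrite (_ : (fun x => _) =
    (fun x => K x (xsection (residual f @^-1` C) x)) \_ A); last first.
  apply/funext => x; rewrite patchE; case: ifPn => xA.
    congr (K x _); apply/seteqP; split=> w; rewrite /xsection /= !inE //=.
      by case.
    by move=> ?; split => //; rewrite inE in xA.
  rewrite (_ : xsection _ _ = set0) ?measure0//.
  apply/seteqP; split=> w //; rewrite /xsection /= inE /= => -[xA' _].
  by rewrite notin_setE in xA.
rewrite -integral_mkcond.
transitivity (\int[l]_(x in A) cst c x)%E; last by rewrite integral_cst// muleC.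
apply: ge0_ae_eq_integral => //.
- apply: measurable_funTS; apply: measurable_fun_xsection_finite_kernel.
  by rewrite inE.
- by move: Kc; apply: filterS => x ? _.
Qed.

(** Basu's argument: the conditional probability of an ancillary event given a
    boundedly complete statistic is constant. *)
Lemma residual_law_const (R : realType) (dV dW : measure_display)
    (V : measurableLmodType R dV) (W : measurableLmodType R dW)
    (f : {mfun V >-> W}) (F : set (probability V R)) (K : R.-pker V ~> W)
    (C : set W) (mC : measurable C) (nu : probability W R)
    (Fc : boundedly_complete F)
    (KE : forall l, F l ->
       (\int[l]_x K x (xsection (residual f @^-1` C) x) = nu C)%E) :
  forall l, F l ->
  {ae l, forall x, K x (xsection (residual f @^-1` C) x) = nu C}.
Proof.
have mTC := measurable_residual_preimage f mC.
apply: (boundedly_complete_ae_eq Fc).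
- by apply: measurable_fun_xsection_finite_kernel; rewrite inE.
- exact: measurable_cst.
- by move=> x; apply: prob_kernel_itv; exact: measurable_xsection.
- by move=> x; rewrite measure_ge0 probability_le1.
- move=> l Fl; rewrite KE//.
  transitivity (\int[l]_x cst (nu C) x)%E; last by [].
  rewrite integral_cst// [X in (_ * X)%E](_ : _ = 1%E) ?mule1//.
  exact: probability_setT.
Qed.

(** * Recovering the second coordinate *)

(** The second coordinate z.2 is the sum of residual z, f z.1 - f v and f v,
    of which the first two are independent with laws nu and L(f | P). *)
Lemma recompose_law (R : realType) (dV dW : measure_display)
    (V : measurableLmodType R dV) (W : measurableLmodType R dW)
    (f : {mfun V >-> W}) (fD : {morph f : x y / x + y})
    (P : probability V R) (nu : probability W R) (v : V)
    (m : probability (V * W)%type R)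
    (mE : forall A C, measurable A -> measurable C ->
      (m (fst @^-1` A `&` residual f @^-1` C) = convolution P \d_v A * nu C)%E)
    (B : set W) (mB : measurable B) :
  m (snd @^-1` B) =
  convolution (convolution nu (distribution P f)) \d_(f v) B.
Proof.
pose phi (z : V * W) : W * W := (residual f z, f z.1 - f v).
have mphi : measurable_fun setT phi.
  apply: measurable_fun_pair; first exact: measurable_residual.
  apply: measurable_fun_addv; last exact: measurable_cst.
  exact: measurableT_comp.
pose m2 : probability (W * W)%type R :=
  distribution m (mfun_Sub (mem_set mphi)).
have nuP : forall D, measurable D -> (nu \x distribution P f)%E D = m2 D.
  apply: product_measure_unique => C A mC mA.
  have mfA : measurable (f @^-1` [set w : W | A (w - f v)]).
    rewrite -[X in measurable X]setTI.
    by apply: (@measurable_funPT _ _ _ _ f) => //; exact: measurable_translate.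
  transitivity (m (fst @^-1` (f @^-1` [set w : W | A (w - f v)])
                   `&` residual f @^-1` C)).
    by rewrite setIC.
  rewrite mE// muleC; congr (_ * _)%E.
  rewrite convolution_diracE//; congr (P _).
  by apply/seteqP; split => x /=; rewrite fD addrK.
rewrite convolution_diracE//.
have mBv := measurable_translate (f v) mB.
transitivity ((nu \x distribution P f)%E
    (@addv_pair R dW W @^-1` [set w | B (w + f v)])); last by [].
rewrite nuP; last by rewrite -[X in measurable X]setTI; exact: measurable_addv.
congr (m _); apply/seteqP; split=> -[x w] /=; rewrite /addv_pair /residual /=;
  by rewrite addrA subrK subrK.
Qed.

(** Convolution with a Dirac measure is a translation, hence cancellable. *)
Lemma convolution_dirac_eq (R : realType) (d : measure_display)
    (W : measurableLmodType R d) (Q N : probability W R) (w0 : W) :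
  (forall B, measurable B -> convolution Q \d_w0 B = convolution N \d_w0 B) ->
  forall w B, measurable B -> convolution Q \d_w B = convolution N \d_w B.
Proof.
move=> QN w B mB; rewrite -(subrKC w0 w).
rewrite (convolution_diracD Q w0 (w - w0) mB).
rewrite (convolution_diracD N w0 (w - w0) mB).
by apply: QN; exact: measurable_translate.
Qed.

Theorem theorem12 (R : realType) (V0 : lmodType R) (Theta : set V0)
    (dV dW : measure_display)
    (V : measurableLmodType R dV) (W : measurableLmodType R dW)
    (W_borel : standard_borel R W)
    (h : V0 -> V) (h_lin : linear h) (h_inj : injective h)
    (f : {mfun V >-> W}) (f_lin : linear f)
    (P : probability V R) (Q : probability W R)
    (K : R.-pker V ~> W)
    (K_conv : forall t, Theta t -> forall B : set W, measurable B ->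
       (convolution Q \d_(f (h t)) B
        = \int[convolution P \d_(h t)]_x K x B)%E)
    (mu : V0 -> probability (V * W)%type R)
    (mu_joint : forall t, Theta t ->
       forall (A : set V) (B : set W), measurable A -> measurable B ->
       (mu t (A `*` B) = \int[convolution P \d_(h t)]_(x in A) K x B)%E)
    (Theta1 : set V0) (Theta1_neq0 : Theta1 !=set0)
    (Theta1_sub : Theta1 `<=` Theta)
    (Theta1D : forall s t, Theta1 s -> Theta1 t -> Theta (s + t))
    (Theta1_complete :
       boundedly_complete [set convolution P \d_(h t) | t in Theta1]) :
  exists nu : probability W R,
    [/\ forall t, Theta1 t -> forall B : set W, measurable B ->
          nu B = pushforward (mu t) (fun z => z.2 - f z.1) B,
        forall t, Theta1 t ->
          independent_rv (mu t) fst (fun z => z.2 - f z.1)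
      & forall t, Theta t -> forall B : set W, measurable B ->
          convolution Q \d_(f (h t)) B =
          convolution (convolution nu (distribution P f)) \d_(f (h t)) B].
Proof.
have hD : {morph h : s t / s + t}.
  by move=> s t; have := h_lin 1 s t; rewrite !scale1r.
have fD : {morph f : x y / x + y}.
  by move=> x y; have := f_lin 1 x y; rewrite !scale1r.
have gD : {morph f \o h : s t / s + t} by move=> s t /=; rewrite hD fD.
have lawD s t C : Theta1 s -> Theta1 t -> measurable C ->
    mu (t + s) (residual f @^-1` C) = mu t (residual f @^-1` C).
  move=> Ts Tt mC.
  rewrite (joint_law_equivariance (mu_joint _ (Theta1_sub _ Tt)) (v := h s)
    (w := f (h s)) (m' := mu (t + s)) (P := P) (K := K)).
  - congr (mu t _); apply/seteqP; split => -[x w] /=.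
      by rewrite /residual /= fD opprD addrACA subrr addr0.
    by rewrite /residual /= fD opprD addrACA subrr addr0.
  - by rewrite -hD; apply: mu_joint; exact: Theta1D.
  - move=> B mB.
    exact: (kernel_equivariance hD gD K_conv Theta1_sub Theta1D
      Theta1_complete).
  - exact: measurable_residual_preimage.
have [t0 Tt0] := Theta1_neq0.
pose nu : probability W R := distribution (mu t0) (residual f).
have nuE t C : Theta1 t -> measurable C -> mu t (residual f @^-1` C) = nu C.
  (* mu_t and mu_t0 are compared through mu_(t + t0). *)
  by move=> Tt mC; rewrite -(lawD t0)// addrC lawD.
have mu_prod t A C : Theta1 t -> measurable A -> measurable C ->
    (mu t (fst @^-1` A `&` residual f @^-1` C)
     = convolution P \d_(h t) A * nu C)%E.
  move=> Tt mA mC.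
  apply: (residual_product_law (mu_joint _ (Theta1_sub _ Tt))) => //.
  apply: (residual_law_const mC Theta1_complete); last by exists t.
  move=> _ [u Tu <-].
  rewrite -(disintegration (mu_joint _ (Theta1_sub _ Tu))) ?nuE//.
  exact: measurable_residual_preimage.
exists nu; split.
- by move=> t Tt C mC; rewrite -(nuE t).
- move=> t Tt A C mA mC.
  have := mu_prod t A setT Tt mA measurableT.
  rewrite preimage_setT setIT probability_setT mule1 => ->.
  by rewrite (nuE t C)//; exact: mu_prod.
- move=> t Tt; apply: (@convolution_dirac_eq _ _ _ _ _ (f (h t0))) => B mB.
  transitivity (mu t0 (snd @^-1` B)); last first.
    by apply: (recompose_law fD) mB => A C mA mC; exact: mu_prod.
  rewrite (K_conv t0 (Theta1_sub _ Tt0) B mB).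
  rewrite -(mu_joint t0 (Theta1_sub _ Tt0) setT B measurableT mB).
  by congr (mu t0 _); apply/seteqP; split=> -[x w] //= [].
Qed.
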